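(* Let $\{S_i\}_{i=1}^m$ be an IFS of contractive similitudes $S_i(x)=B^{-1}(x+d_i)$ on $\mathbb R^d$, where $B^{-1}=rR$ with $0<r<1$ and $R$ orthogonal, and let $X$ be the augmented tree defined with a bounded closed invariant set $J$. Let $T_1\subset\Sigma^{k_1}$ and $T_2\subset\Sigma^{k_2}$ be two horizontal connected components with $\#T_1=\#T_2=\ell$. If there exist similitudes $\phi_i(x)=B^{k_i}x+c_i$, $i=1,2$, where $c_i\in\mathbb R^d$, such that $$\phi_1\Big(\bigcup_{\mathbf i\in T_1}J_{\mathbf i}\Big)=\phi_2\Big(\bigcup_{\mathbf j\in T_2}J_{\mathbf j}\Big)=J\cup(J+v_1)\cup\cdots\cup(J+v_{\ell-1})$$ for some vectors $v_1,\dots,v_{\ell-1}\in\mathbb R^d$, then $T_1\sim T_2$.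
   Context: $\Sigma=\{1,\dots,m\}$, $X=\bigcup_{n\ge0}\Sigma^n$, where $\Sigma^0$ consists of the empty word $o$ (the root); $S_{\mathbf u}=S_{i_1}\circ\cdots\circ S_{i_n}$ for $\mathbf u=i_1\cdots i_n$. $J\subset\mathbb R^d$ is a fixed bounded closed set with $S_i(J)\subset J$ for all $i$, and $J_{\mathbf u}=S_{\mathbf u}(J)$. For $\mathbf i=i_1\cdots i_k\in\Sigma^k$, $J_{\mathbf i}=B^{-k}(J+d_{\mathbf i})$ with $d_{\mathbf i}=d_{i_k}+Bd_{i_{k-1}}+\cdots+B^{k-1}d_{i_1}$. Augmented tree: the graph on $X$ with vertical edges joining $\mathbf u$ and $\mathbf ui$ ($i\in\Sigma$), and horizontal edges joining distinct $\mathbf u,\mathbf v$ in the same level $\Sigma^n$ with $J_{\mathbf u}\cap J_{\mathbf v}\ne\emptyset$. A horizontal connected component is a maximal connected horizontal subgraph of some level $\Sigma^n$. For such a component $T$, $T\Sigma=\{\mathbf ui:\mathbf u\in T,\ i\in\Sigma\}$. $T\sim T'$ means there is a bijection $g:T\cup T\Sigma\to T'\cup T'\Sigma$ (both regarded as subgraphs of $X$) such that $g$ and $g^{-1}$ preserve vertical and horizontal edges.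
   Formalization: The displayed equality is required piece by piece: for i=1,2 the sets φ_i(J_w), w in T_i, are, counted with multiplicity and up to order, exactly J, J+v_1, ..., J+v_{ℓ-1}; equality of the unions alone does not imply T_1 ~ T_2. *)

(* Defs.v *)
From HB Require Import structures.
From mathcomp Require Import all_boot all_order all_algebra.
From mathcomp Require Import all_classical all_reals all_analysis.
Import Order.TTheory GRing.Theory Num.Theory.
Import numFieldNormedType.Exports.

Set Implicit Arguments.
Unset Strict Implicit.
Unset Printing Implicit Defensive.

Local Open Scope classical_set_scope.
Local Open Scope ring_scope.

(* Words over the alphabet are sequences [seq 'I_m]; the root is [::], and the
   k-th level is embedded from [k.-tuple 'I_m] by the coercion to sequences. *)

Definition ifs_map (R : realType) (n m : nat) (B : 'M[R]_n)
    (d : 'I_m -> 'cV[R]_n) (i : 'I_m) (x : 'cV[R]_n) : 'cV[R]_n :=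
  invmx B *m (x + d i).

(* S_u = S_(i_1) o ... o S_(i_k): the first letter is applied last. *)
Definition word_map (R : realType) (n m : nat) (B : 'M[R]_n)
    (d : 'I_m -> 'cV[R]_n) (u : seq 'I_m) : 'cV[R]_n -> 'cV[R]_n :=
  foldr (fun i f => ifs_map B d i \o f) idfun u.

Definition cell (R : realType) (n m : nat) (B : 'M[R]_n)
    (d : 'I_m -> 'cV[R]_n) (J : set 'cV[R]_n) (u : seq 'I_m) : set 'cV[R]_n :=
  word_map B d u @` J.

Definition vertical_edge (m : nat) (u v : seq 'I_m) : Prop :=
  exists i : 'I_m, v = rcons u i \/ u = rcons v i.

Definition horizontal_edge (R : realType) (n m : nat) (B : 'M[R]_n)
    (d : 'I_m -> 'cV[R]_n) (J : set 'cV[R]_n) (u v : seq 'I_m) : Prop :=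
  [/\ size u = size v, u <> v & cell B d J u `&` cell B d J v !=set0].

(* Connectedness of the subgraph induced on A: paths must stay inside A. *)
Definition horizontal_connected (R : realType) (n m : nat) (B : 'M[R]_n)
    (d : 'I_m -> 'cV[R]_n) (J : set 'cV[R]_n) (k : nat)
    (A : {set k.-tuple 'I_m}) : bool :=
  (A != finset.set0) &&
  [forall u in A, forall v in A,
     connect [rel x y : k.-tuple 'I_m |
               [&& x \in A, y \in A & `[< horizontal_edge B d J x y >]]] u v].

Definition horizontal_component (R : realType) (n m : nat) (B : 'M[R]_n)
    (d : 'I_m -> 'cV[R]_n) (J : set 'cV[R]_n) (k : nat)
    (T : {set k.-tuple 'I_m}) : bool :=
  maxset (@horizontal_connected R n m B d J k) T.

(* T together with T Sigma. *)
Definition with_children (m k : nat) (T : {set k.-tuple 'I_m}) :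
    set (seq 'I_m) :=
  [set w | exists2 u : k.-tuple 'I_m,
             u \in T & w = tval u \/ exists i : 'I_m, w = rcons u i].

(* T ~ T'.  With g bijective, the two equivalences say that both g and its
   inverse preserve edges. *)
Definition component_equiv (R : realType) (n m : nat) (B : 'M[R]_n)
    (d : 'I_m -> 'cV[R]_n) (J : set 'cV[R]_n) (k k' : nat)
    (T : {set k.-tuple 'I_m}) (T' : {set k'.-tuple 'I_m}) : Prop :=
  exists g : seq 'I_m -> seq 'I_m,
    set_bij (with_children T) (with_children T') g /\
    forall u v, with_children T u -> with_children T v ->
      (vertical_edge u v <-> vertical_edge (g u) (g v)) /\
      (horizontal_edge B d J u v <-> horizontal_edge B d J (g u) (g v)).

Definition translate (R : realType) (n : nat) (J : set 'cV[R]_n)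
    (v : 'cV[R]_n) : set 'cV[R]_n :=
  [set x + v | x in J].

(* The cells of T, carried by phi, are J + v_0, ..., J + v_(l-1) up to order,
   counted with multiplicity.  Equality of the unions alone does not determine
   the pieces: on the line, with B = 8, J = [0, 1] and
   d = (0, 1/2, 1, 2, 4, 9/2, 11/2, 6), the letters of the first four and of the
   last four translations form two components of the first level whose cells
   have unions [0, 3]/8 and [4, 7]/8, but the first contains a triangle and the
   second is a path. *)
Definition pieces_are_translates (R : realType) (n m : nat) (B : 'M[R]_n)
    (d : 'I_m -> 'cV[R]_n) (J : set 'cV[R]_n) (k : nat)
    (T : {set k.-tuple 'I_m}) (phi : 'cV[R]_n -> 'cV[R]_n) (l : nat)
    (v : 'I_l -> 'cV[R]_n) : Prop :=
  exists e : 'I_l -> k.-tuple 'I_m,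
    set_bij setT [set` T] e /\
    forall s, phi @` cell B d J (e s) = translate J (v s).

(* Main.v *)
Require Import Defs.
From HB Require Import structures.
From mathcomp Require Import all_boot all_order all_algebra.
From mathcomp Require Import all_classical all_reals all_analysis.
Import Order.TTheory GRing.Theory Num.Theory.
Import numFieldNormedType.Exports.

Set Implicit Arguments.
Unset Strict Implicit.
Unset Printing Implicit Defensive.

Local Open Scope classical_set_scope.
Local Open Scope ring_scope.

(** A cell of level [k] is [S_u J], and [B ^+ k *m S_u x] is [x] plus a constant,
    so [phi] carries it to a translate of [J].  A bounded nonempty set
    determines the vector by which it was translated
    ([translate_bounded_inj]); hence, if [phi] carries the cell of [e s] to
    [J + v s], then [phi \o S_(e s)] is the translation by [v s] as a map and not
    merely on [J].  Because [S_(e s ++ w) = S_(e s) \o S_w], every descendant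
    [e s ++ w] then satisfies [phi (J_(e s ++ w)) = J_w + v s]
    ([image_cell_cat]).  As [phi] is injective, whether [e s ++ w] and
    [e t ++ w'] are adjacent is a condition on [s], [w], [t], [w'] and [v]
    in which the component no longer appears ([horizontal_edge_cat],
    [vertical_edge_cat]).

    Enumerate [T1] by [e1] and [T2] by [e2], with the same vectors [v].  The map
    sending [e1 s ++ w] to [e2 s ++ w] therefore preserves both kinds of edges,
    and it restricts to a bijection between the components together with their
    children, which are the words with [size w <= 1]. *)

(** Iterating the inclusion [J + t = J] with [t = a - b] puts [x + N t] in [J]
    for every [N], which is incompatible with boundedness unless [t = 0]. *)
Lemma translate_bounded_inj (R : realType) (n : nat) (J : set 'cV[R]_n)
    (a b : 'cV[R]_n) :
  bounded_set J -> J !=set0 -> translate J a = translate J b -> a = b.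
Proof.
move=> [M [_ J_bound]] [x Jx] eqJ.
have J_step y : J y -> J (y + (a - b)).
  move=> Jy.
  have [z Jz zbE] : translate J b (y + a) by rewrite -eqJ; exists y.
  by rewrite addrA -zbE addrK.
have J_iter N : J (x + (a - b) *+ N).
  elim: N => [|N JN]; first by rewrite mulr0n addr0.
  by rewrite mulrSr addrA; exact: J_step.
have J_le y : J y -> `|y| <= M + 1 by apply: J_bound; rewrite ltrDl.
apply/eqP; rewrite -subr_eq0 -normr_eq0; apply/negPn/negP => t_neq0.
have t_gt0 : 0 < `|a - b| by rewrite lt_def t_neq0 normr_ge0.
set C := (M + 1) + (M + 1).
have iter_le N : `|a - b| *+ N <= C.
  rewrite -normrMn -[(a - b) *+ N](addKr x) addrC.
  by apply: le_trans (ler_normB _ _) _; apply: lerD; exact: J_le.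
have C_ge0 : 0 <= C by have := iter_le 0%N; rewrite mulr0n.
have := archi_boundP (divr_ge0 C_ge0 (ltW t_gt0)).
rewrite ltr_pdivrMr // mulr_natl => /lt_le_trans /(_ (iter_le _)).
by rewrite ltxx.
Qed.

Lemma set_bij_setT_inj (T U : Type) (A : set U) (f : T -> U) :
  set_bij setT A f -> injective f.
Proof. by move=> [_ f_inj _] x y; apply: f_inj; rewrite in_setT. Qed.

Lemma word_map_cat (R : realType) (n m : nat) (B : 'M[R]_n)
    (d : 'I_m -> 'cV[R]_n) (u w : seq 'I_m) (x : 'cV[R]_n) :
  word_map B d (u ++ w) x = word_map B d u (word_map B d w x).
Proof. by elim: u => //= i u ->. Qed.

(** The constant [a] is the vector [d_u] of the formula
    [S_u x = B ^- k (x + d_u)]. *)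
Lemma expanded_word_map (R : realType) (n m : nat) (B : 'M[R]_n)
    (d : 'I_m -> 'cV[R]_n) (u : seq 'I_m) :
  B \in unitmx ->
  exists a, forall x, B ^+ size u *m word_map B d u x = x + a.
Proof.
move=> B_unit; elim: u => [|i u [a IHu]] /=.
  by exists 0 => x; rewrite expr0 mul1mx addr0.
exists (a + B ^+ size u *m d i) => x.
by rewrite exprSr -mulmxA /ifs_map mulKVmx // mulmxDr IHu addrA.
Qed.

Lemma expansion_inj (R : realType) (n k : nat) (B : 'M[R]_n) (c : 'cV[R]_n) :
  B \in unitmx -> injective (fun x : 'cV[R]_n => B ^+ k *m x + c).
Proof.
move=> B_unit x y /addIr eqxy.
have Bk_unit : B ^+ k \in unitmx.
  elim: k {eqxy} => [|k IHk]; first by rewrite expr0 unitmx1.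
  by rewrite exprS unitmx_mul B_unit.
by rewrite -(mulKmx Bk_unit x) eqxy mulKmx.
Qed.

(** Comparing translates of [J] determines [phi \o S_u] as a map, so the
    hypothesis on the cell of [u] controls the cells of all its descendants.
    An empty [J] carries no information, but then all cells are empty. *)
Lemma image_cell_cat (R : realType) (n m : nat) (B : 'M[R]_n)
    (d : 'I_m -> 'cV[R]_n) (J : set 'cV[R]_n) (u w : seq 'I_m)
    (c v : 'cV[R]_n) :
  B \in unitmx -> bounded_set J ->
  (fun x => B ^+ size u *m x + c) @` cell B d J u = translate J v ->
  (fun x => B ^+ size u *m x + c) @` cell B d J (u ++ w) =
  translate (cell B d J w) v.
Proof.
move=> B_unit J_bounded.
have [->|J_neq0] := eqVneq J classical_sets.set0.
  by rewrite /cell /translate !image_set0.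
have [a expandE] := expanded_word_map d u B_unit.
have -> : (fun x => B ^+ size u *m x + c) @` cell B d J u = translate J (a + c).
  rewrite /cell image_comp /translate; apply: eq_imagel => x _ /=.
  by rewrite expandE addrA.
move/translate_bounded_inj => /(_ J_bounded (iffLR (set0P _) J_neq0)) <-.
rewrite /cell /translate !image_comp; apply: eq_imagel => x _ /=.
by rewrite word_map_cat expandE addrA.
Qed.

Lemma tuple_cat_inj (m k l : nat) (e : 'I_l -> k.-tuple 'I_m) :
  injective e ->
  forall s t w w', e s ++ w = e t ++ w' <-> s = t /\ w = w'.
Proof.
move=> e_inj s t w w'; split=> [/eqP|[-> -> //]].
by rewrite eqseq_cat ?size_tuple // => /andP[/eqP/val_inj/e_inj -> /eqP ->].
Qed.

Lemma vertical_edge_cat (m k l : nat) (e : 'I_l -> k.-tuple 'I_m) :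
  injective e ->
  forall s t w w',
    vertical_edge (e s ++ w) (e t ++ w') <-> s = t /\ vertical_edge w w'.
Proof.
move=> e_inj s t w w'; split=> [[i]|[-> [i [->|->]]]].
- rewrite !rcons_cat => -[] /(tuple_cat_inj e_inj) [-> ->].
  + by split=> //; exists i; left.
  + by split=> //; exists i; right.
- by exists i; left; rewrite rcons_cat.
- by exists i; right; rewrite rcons_cat.
Qed.

(** The condition on the right involves neither [k], [e] nor [c]: components of
    different levels described by the same vectors [v] satisfy the same one. *)
Lemma horizontal_edge_cat (R : realType) (n m : nat) (B : 'M[R]_n)
    (d : 'I_m -> 'cV[R]_n) (J : set 'cV[R]_n) (k l : nat)
    (e : 'I_l -> k.-tuple 'I_m) (c : 'cV[R]_n) (v : 'I_l -> 'cV[R]_n) :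
  B \in unitmx -> bounded_set J -> injective e ->
  (forall s, (fun x => B ^+ k *m x + c) @` cell B d J (e s) =
             translate J (v s)) ->
  forall s t w w',
    horizontal_edge B d J (e s ++ w) (e t ++ w') <->
    [/\ size w = size w', ~ (s = t /\ w = w') &
        translate (cell B d J w) (v s) `&` translate (cell B d J w') (v t)
          !=set0].
Proof.
move=> B_unit J_bounded e_inj cellE s t w w'.
have descE p y : (fun x => B ^+ k *m x + c) @` cell B d J (e p ++ y) =
                 translate (cell B d J y) (v p).
  have := @image_cell_cat R n m B d J (e p) y c (v p) B_unit J_bounded.
  by rewrite size_tuple; apply.
have phi_inj := @expansion_inj R n k B c B_unit.
split=> -[size_eq neq meet]; split.
- by move: size_eq; rewrite !size_cat !size_tuple => /addnI.
- by move/(tuple_cat_inj e_inj).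
- by case: meet => x [x1 x2]; rewrite -!descE; eexists; split; exists x.
- by rewrite !size_cat !size_tuple size_eq.
- by move/(tuple_cat_inj e_inj).
- move: meet; rewrite -!descE => -[_ [[x xP <-] [y yP /phi_inj eqyx]]].
  by exists x; split=> //; rewrite -eqyx.
Qed.

Lemma with_childrenP (m k l : nat) (T : {set k.-tuple 'I_m})
    (e : 'I_l -> k.-tuple 'I_m) :
  set_bij setT [set` T] e ->
  forall u, with_children T u <-> exists s w, (size w <= 1)%N /\ u = e s ++ w.
Proof.
move=> [e_fun _ e_surj] u; split.
- move=> [x /e_surj [s _ <-] [->|[i ->]]].
  + by exists s, [::]; rewrite cats0.
  + by exists s, [:: i]; rewrite cats1.
- move=> [s [[|i [|j w]] [// _ ->]]]; exists (e s); try exact: e_fun.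
  + by left; rewrite cats0.
  + by right; exists i; rewrite cats1.
Qed.

(** The bijection [e s ++ w |-> e' s ++ w], extended arbitrarily to all words
    because an equivalence of components is given by a total function. *)
Definition replace_prefix (m k k' l : nat) (e : 'I_l -> k.-tuple 'I_m)
    (e' : 'I_l -> k'.-tuple 'I_m) (u : seq 'I_m) : seq 'I_m :=
  if [pick s | tval (e s) == take k u] is Some s
  then e' s ++ drop k u else u.

Lemma replace_prefix_cat (m k k' l : nat) (e : 'I_l -> k.-tuple 'I_m)
    (e' : 'I_l -> k'.-tuple 'I_m) :
  injective e -> forall s w, replace_prefix e e' (e s ++ w) = e' s ++ w.
Proof.
move=> e_inj s w; rewrite /replace_prefix.
rewrite take_size_cat ?size_tuple // drop_size_cat ?size_tuple //.
by case: pickP => [t /eqP/val_inj/e_inj -> //|/(_ s)]; rewrite eqxx.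
Qed.

Lemma replace_prefix_bij (m k k' l : nat) (T : {set k.-tuple 'I_m})
    (T' : {set k'.-tuple 'I_m}) (e : 'I_l -> k.-tuple 'I_m)
    (e' : 'I_l -> k'.-tuple 'I_m) :
  set_bij setT [set` T] e -> set_bij setT [set` T'] e' ->
  set_bij (with_children T) (with_children T') (replace_prefix e e').
Proof.
move=> e_bij e'_bij.
have e_inj := set_bij_setT_inj e_bij.
have e'_inj := set_bij_setT_inj e'_bij.
split.
- move=> _ /(with_childrenP e_bij) [s [w [w_le1 ->]]].
  by rewrite replace_prefix_cat //; apply/(with_childrenP e'_bij); exists s, w.
- move=> x y /set_mem/(with_childrenP e_bij) [s [w [_ ->]]].
  move=> /set_mem/(with_childrenP e_bij) [t [w' [_ ->]]].
  by rewrite !replace_prefix_cat // => /(tuple_cat_inj e'_inj) [-> ->].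
- move=> _ /(with_childrenP e'_bij) [s [w [w_le1 ->]]].
  exists (e s ++ w); last exact: replace_prefix_cat.
  by apply/(with_childrenP e_bij); exists s, w.
Qed.

Theorem lemma5p1 (R : realType) (n m : nat)
    (B : 'M[R]_n) (r : R) (Q : 'M[R]_n) (d : 'I_m -> 'cV[R]_n)
    (J : set 'cV[R]_n)
    (k1 k2 l : nat)
    (T1 : {set k1.-tuple 'I_m}) (T2 : {set k2.-tuple 'I_m})
    (c1 c2 : 'cV[R]_n) (v : 'I_l -> 'cV[R]_n)
    (B_unit : B \in unitmx) (B_inv : invmx B = r *: Q)
    (r_gt0 : 0 < r) (r_lt1 : r < 1) (Q_orth : Q *m Q^T = 1%:M)
    (J_bounded : bounded_set J) (J_closed : closed J)
    (J_invariant : forall i, ifs_map B d i @` J `<=` J)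
    (T1_comp : horizontal_component B d J T1)
    (T2_comp : horizontal_component B d J T2)
    (T1_card : #|T1| = l) (T2_card : #|T2| = l)
    (v_0 : forall s : 'I_l, s = 0%N :> nat -> v s = 0)
    (union1 : (fun x => B ^+ k1 *m x + c1) @`
                (\bigcup_(i in [set` T1]) cell B d J i)
              = \bigcup_(s in [set: 'I_l]) translate J (v s))
    (union2 : (fun x => B ^+ k2 *m x + c2) @`
                (\bigcup_(j in [set` T2]) cell B d J j)
              = \bigcup_(s in [set: 'I_l]) translate J (v s))
    (pieces1 : pieces_are_translates B d J T1
                 (fun x => B ^+ k1 *m x + c1) v)
    (pieces2 : pieces_are_translates B d J T2
                 (fun x => B ^+ k2 *m x + c2) v) :
  component_equiv B d J T1 T2.
Proof.
have [e1 [e1_bij cellE1]] := pieces1.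
have [e2 [e2_bij cellE2]] := pieces2.
have e1_inj := set_bij_setT_inj e1_bij.
have e2_inj := set_bij_setT_inj e2_bij.
exists (replace_prefix e1 e2); split; first exact: replace_prefix_bij.
move=> x y /(with_childrenP e1_bij) [s [w [_ ->]]].
move=> /(with_childrenP e1_bij) [t [w' [_ ->]]].
rewrite !replace_prefix_cat //; split.
- exact: iff_trans (vertical_edge_cat e1_inj _ _ _ _)
    (iff_sym (vertical_edge_cat e2_inj _ _ _ _)).
- exact: iff_trans
    (horizontal_edge_cat B_unit J_bounded e1_inj cellE1 _ _ _ _)
    (iff_sym (horizontal_edge_cat B_unit J_bounded e2_inj cellE2 _ _ _ _)).
Qed.
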